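(* For all integers $D,q,r\geq 2$ there is a constant $c=c(D,q,r)$ such that for every positive integer $n$ and every graph $H$ on $n$ vertices with $\Delta(H)<D$, $$\hat{R}_r(H^q)\leq USR(D,q,r,n)\leq c\,n^{1+1/q}.$$
   Context: $\Delta(H)$ denotes the maximum degree of $H$. For a graph $H$, $H^q$ denotes the graph obtained from $H$ by subdividing each edge with $q-1$ new vertices, i.e. replacing each edge by a path of length $q$ (these paths being internally disjoint). We write $G\xrightarrow{}(F)_r$ if for every coloring of the edges of $G$ with $r$ colors there is a monochromatic copy of $F$ in $G$ (as a not necessarily induced subgraph). The $r$-size-Ramsey number is $\hat{R}_r(F)=\min\{|E(G)|: G\xrightarrow{}(F)_r\}$. The universal size-Ramsey number $USR(D,q,r,n)$ is the smallest number of edges a graph $G$ can have such that $G\xrightarrow{}(H^q)_r$ for all graphs $H$ on $n$ vertices with $\Delta(H)\leq D$. *)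

(* Defs.v *)
From mathcomp Require Import all_boot.
From mathcomp Require Import boolp zify.

Set Implicit Arguments.
Unset Strict Implicit.
Unset Printing Implicit Defensive.

Local Open Scope nat_scope.

Record sgraph := SGraph {
  vertex :> finType;
  adj : rel vertex;
  adj_sym : symmetric adj;
  adj_irrefl : irreflexive adj }.

Definition edges (G : sgraph) : {set {set G}} :=
  [set e | [exists x, exists y, adj x y && (e == [set x; y])]].

Definition max_degree (G : sgraph) : nat :=
  \max_(x : G) #|[set y | adj x y]|.

(* Only the values of [col] on [edges G] matter, so for [0 < r] this quantifies
   over the colourings of the edges of [G]. Copies are not necessarily
   induced, and isolated vertices of [F] must be embedded as well. *)
Definition arrows (r : nat) (G F : sgraph) : Prop :=
  forall col : {set G} -> 'I_r,
    exists (f : F -> G) (k : 'I_r),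
      injective f /\
      forall x y : F, adj x y -> adj (f x) (f y) /\ col [set f x; f y] = k.

Section Subdivision.
Variables (q : nat) (H : sgraph).

(* Each edge of [H] gets exactly one orientation, from the enumeration order. *)
Definition arc : finType :=
  {p : H * H | adj p.1 p.2 && (enum_rank p.1 < enum_rank p.2)}.

Definition subdiv_vertex : finType := (H + arc * 'I_q.-1)%type.

(* The [i]-th vertex (0 <= i <= q) of the path of length [q] replacing [a]:
   its tail for [i = 0], its head for [i = q], a new vertex in between. *)
Definition path_vertex (a : arc) (i : nat) : subdiv_vertex :=
  if i is j.+1 then
    if insub j is Some k then inr (a, k) else inl (val a).2
  else inl (val a).1.

Definition subdiv_adj : rel subdiv_vertex := fun u v =>
  [exists a : arc, exists i : 'I_q,
    ((u == path_vertex a i) && (v == path_vertex a i.+1)) ||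
    ((v == path_vertex a i) && (u == path_vertex a i.+1))].

Lemma subdiv_adj_sym : symmetric subdiv_adj.
Proof.
by move=> u v; apply: eq_existsb => a; apply: eq_existsb => i; rewrite orbC.
Qed.

Lemma path_vertexS_neq (a : arc) (i : 'I_q) :
  path_vertex a i != path_vertex a i.+1.
Proof.
have Ha : (val a).1 != (val a).2.
  by case: a => -[x y] /= /andP[+ _]; apply: contraTneq => ->; rewrite adj_irrefl.
case: i => -[|j] ltjq; rewrite /path_vertex /=.
  by case: insubP => //=; rewrite -topredE /=; case: eqVneq => // -[] /eqP; rewrite (negPf Ha).
case: insubP => [k _ kE|]; last by rewrite -ltnS (ltn_predK ltjq) ltjq.
case: insubP => [k' _ k'E|] //; apply/eqP => -[] /(congr1 val) /=.
by rewrite kE k'E => /n_Sn.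
Qed.

Lemma subdiv_adj_irrefl : irreflexive subdiv_adj.
Proof.
move=> u; apply/negbTE/negP => /existsP[a /existsP[i]]; rewrite orbb.
by move=> /andP[/eqP uE]; rewrite {1}uE (negPf (path_vertexS_neq a i)).
Qed.

Definition subdiv : sgraph := SGraph subdiv_adj_sym subdiv_adj_irrefl.

Lemma card_subdiv : #|subdiv| <= #|H| + #|H| * #|H| * q.
Proof.
rewrite card_sum card_prod card_ord leq_add2l leq_mul ?leq_pred//.
by rewrite card_sig -card_prod max_card.
Qed.

End Subdivision.

Section Ramsey.

Definition complete (n : nat) : sgraph :=
  @SGraph 'I_n (fun x y => x != y) (fun x y => f_equal negb (eq_sym x y))
    (fun x => f_equal negb (eqxx x)).

Lemma ramsey_seq (r k : nat) (T : finType) (col : {set T} -> 'I_r)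
    (A : {set T}) : r.+1 ^ k <= #|A| ->
  exists s : seq (T * 'I_r), [/\ size s = k, all (fun p => p.1 \in A) s &
    pairwise (fun p p' => (p.1 != p'.1) && (col [set p.1; p'.1] == p.2)) s].
Proof.
elim: k A => [|k IHk] A leA; first by exists [::].
have /card_gt0P[x xA] : 0 < #|A| by apply: leq_trans leA; rewrite expn_gt0.
pose B a := [set y in A :\ x | col [set x; y] == a].
have [a leB] : exists a, r.+1 ^ k <= #|B a|.
  apply/existsP; apply: contraLR leA => /existsPn ltB; rewrite -ltnNge.
  have -> : #|A| = (\sum_a #|B a|).+1.
    rewrite (cardsD1 x) xA add1n; congr _.+1.
    rewrite -sum1_card (partition_big (fun y => col [set x; y]) predT) //=.
    by apply: eq_bigr => a _; rewrite -sum1_card; apply: eq_bigl => y; rewrite !inE.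
  have : \sum_a #|B a| <= \sum_(a < r) (r.+1 ^ k).-1.
    apply: leq_sum => a _; have := ltB a; rewrite -ltnNge.
    by case: (r.+1 ^ k).
  rewrite sum_nat_const card_ord expnS mulSn.
  have : 0 < r.+1 ^ k by rewrite expn_gt0.
  have : 0 < r by case: (r) (col set0) => [[]|].
  case: (r.+1 ^ k) => // m r_gt0 _ /= le_sum.
  by rewrite addSn ltnS (leq_ltn_trans le_sum)// mulnS; lia.
have [s [sz_s /allP sB pw_s]] := IHk _ leB.
exists ((x, a) :: s); split => /=; first by rewrite sz_s.
  by rewrite xA; apply/allP => p /sB; rewrite !inE => /andP[/andP[]].
rewrite pw_s andbT; apply/allP => p /sB; rewrite !inE /= eq_sym.
by move=> /andP[/andP[-> _] ->].
Qed.

Lemma complete_arrows (r M : nat) (F : sgraph) : #|F| <= M ->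
  arrows r (complete (r.+1 ^ (r * M))) F.
Proof.
move=> leFM col.
have r_gt0 : 0 < r by case: (r) (col set0) => [[]|].
have [|s [sz_s _ pw_s]] := @ramsey_seq r (r * M) _ col setT.
  by rewrite cardsT card_ord.
have [a leMa] : exists a, M <= count (fun p => p.2 == a) s.
  have [M0|M_gt0] := posnP M.
    by exists (Ordinal r_gt0); apply: leq_trans (leq0n _); rewrite M0.
  apply/existsP; apply: contraT => /existsPn lt_c.
  have szE : size s = \sum_(a < r) count (fun p => p.2 == a) s.
    elim: (s) => [|p t IHt] /=; first by rewrite big1.
    rewrite big_split /= -IHt -add1n; congr (_ + _).
    by rewrite (bigD1 p.2) //= eqxx big1 // => b /negPf; rewrite eq_sym => ->.
  have : size s <= \sum_(a < r) M.-1.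
    rewrite szE; apply: leq_sum => a _.
    by rewrite -ltnS (prednK M_gt0) ltnNge; apply: lt_c.
  by rewrite sum_nat_const card_ord sz_s leq_pmul2l // -ltnS prednK // ltnn.
pose P := fun p p' : _ * 'I_r => (p.1 != p'.1) && (col [set p.1; p'.1] == p.2).
pose t := [seq p <- s | p.2 == a].
have sz_t : #|F| <= size t by rewrite size_filter (leq_trans leFM).
have pw_t : pairwise P t.
  exact: subseq_pairwise (filter_subseq _ _) pw_s.
have [F0|F_gt0] := posnP #|F|.
  have noF (x : F) : False by have := card0_eq F0 x.
  by exists (fun x => match noF x with end), a; split => x; case: (noF x).
case tE: t => [|p0 t']; first by move: sz_t; rewrite tE leqNgt F_gt0.
pose f (x : F) := nth p0 t (enum_rank x).
have lt_t (x : F) : enum_rank x < size t by apply: leq_trans (ltn_ord _) sz_t.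
have fP (x y : F) : enum_rank x < enum_rank y ->
    ((f x).1 != (f y).1) && (col [set (f x).1; (f y).1] == a).
  move=> ltxy; have /andP[-> /eqP->] := pairwiseP p0 pw_t _ _ (lt_t x) (lt_t y) ltxy.
  by have := mem_nth p0 (lt_t x); rewrite mem_filter => /andP[].
have fP' (x y : F) : x != y ->
    ((f x).1 != (f y).1) && (col [set (f x).1; (f y).1] == a).
  move=> neq_xy; have : enum_rank x != enum_rank y by rewrite (inj_eq enum_rank_inj).
  rewrite -(inj_eq val_inj) neq_ltn => /orP[/fP//|/fP].
  by rewrite eq_sym finset.setUC.
exists (fun x => (f x).1), a; split => [x y fxy|x y adjxy].
  by apply/eqP; apply: contraPT fxy => /fP' /andP[/eqP].
have /fP' /andP[neq_f /eqP col_f] : x != y; last by split.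
by apply: contraTneq adjxy => ->; rewrite adj_irrefl.
Qed.

Lemma ramsey_exists (r : nat) (F : sgraph) : exists G : sgraph, arrows r G F.
Proof. by eexists; exact: complete_arrows (leqnn #|F|). Qed.

Lemma universal_ramsey_exists (D q r n : nat) :
  exists G : sgraph, forall H : sgraph, #|H| = n -> max_degree H <= D ->
    arrows r G (subdiv q H).
Proof.
exists (complete (r.+1 ^ (r * (n + n * n * q)))) => H Hn _.
by apply: complete_arrows; rewrite -Hn card_subdiv.
Qed.

End Ramsey.

Section MinEdges.
Variables (P : sgraph -> Prop) (exP : exists G, P G).

Let has_edge_count (m : nat) : bool :=
  `[< exists G : sgraph, #|edges G| = m /\ P G >].

Fact has_edge_count_exists : exists m, has_edge_count m.
Proof. by have [G PG] := exP; exists #|edges G|; apply/asboolP; exists G. Qed.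

Definition min_edges : nat := ex_minn has_edge_count_exists.

End MinEdges.

Definition size_ramsey (r : nat) (F : sgraph) : nat :=
  min_edges (ramsey_exists r F).

Definition USR (D q r n : nat) : nat :=
  min_edges (universal_ramsey_exists D q r n).

(* Main.v *)
Require Import Defs.
From mathcomp Require Import all_boot all_order all_algebra.
From mathcomp Require Import reals exp.
From mathcomp Require Import zify.

Set Implicit Arguments.
Unset Strict Implicit.

Import Order.TTheory GRing.Theory Num.Theory.

(* Let [m] be a large constant times [n ^ (1 / q)] and [R] a large constant. The
   host graph is the de Bruijn graph on words of length [q] over the alphabet
   [R] types x [m] letters; it has [O(m ^ (q + 1)) = O(n ^ (1 + 1 / q))] edges,
   which correspond to words of length [q + 1], and reading the words of length
   [q] inside [x y] gives a path of length [q] from the word [x] to the word [y].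

   Given an edge colouring, hypergraph Ramsey on the types and averaging over the
   letters give [t = D ^ 2 + D + 1] blocks of [q] types and a colour such that a
   positive proportion of the [t]-tuples of words are cliques, that is, all paths
   between their components have this colour. A box in the space of [t]-tuples
   maximizing [|cliques| ^ s / volume ^ (s - 1)] has linear sides and stays
   dense in all sub-boxes with two linear sides shrunk.

   Colour [H] so that vertices at distance at most two get distinct colours, and
   embed its vertices greedily into the sides of the box prescribed by their
   colours. The edges between two colour classes then form a matching. Two paths
   between the same two sides meet in an inner vertex only if their starts share
   a suffix and their ends share the complementary prefix. Hence it is enough to
   put few vertices in each set of words sharing some letters: few words are then
   blocked at each step. *)

Local Open Scope nat_scope.

(** * Hypergraph Ramsey *)

Section Ramsey.

Lemma pigeonhole_count (r L : nat) (T : eqType) (t : seq (T * 'I_r)) :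
  0 < r -> r * L <= size t -> exists c, L <= count (fun p => p.2 == c) t.
Proof.
move=> r_gt0 leL; have szE : size t = \sum_(c < r) count (fun p => p.2 == c) t.
  elim: (t) => [|p t' IHt] /=; first by rewrite big1.
  rewrite big_split /= -IHt -add1n; congr (_ + _).
  by rewrite (bigD1 p.2) //= eqxx big1 // => b /negPf; rewrite eq_sym => ->.
case: L leL => [|L] leL; first by exists (Ordinal r_gt0).
apply/existsP; apply: contraT => /existsPn lt_c.
have : size t <= \sum_(c < r) L.
  by rewrite szE; apply: leq_sum => c _; rewrite -ltnS ltnNge; apply: lt_c.
rewrite sum_nat_const card_ord => /(leq_trans leL).
by rewrite leq_pmul2l // ltnn.
Qed.

(** Induction on [k]: repeatedly split off the first element [x] and pass to a later subsequence on
    which the colour of [x] followed by [k] elements is constant. Colours then depend on the first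
    element alone, and pigeonhole finishes. *)
Lemma ramsey_subseq (r k L : nat) : exists R, forall (T : eqType)
    (chi : seq T -> 'I_r) (s : seq T), R <= size s ->
  exists (c : 'I_r) (t : seq T), [/\ subseq t s, size t = L &
    forall x, subseq x t -> size x = k -> chi x = c].
Proof.
elim: k L => [|k IHk] L.
  exists L => T chi s leL; exists (chi [::]), (take L s).
  by split; [exact: take_subseq | exact: size_takel | move=> x _ /size0nil ->].
have [R HR] : exists R, forall (T : eqType) (chi : seq T -> 'I_r) (s : seq T),
    R <= size s -> exists t : seq (T * 'I_r),
    [/\ subseq (unzip1 t) s, size t = r * L & forall p y, subseq (p :: y) t ->
        size y = k -> chi (p.1 :: unzip1 y) = p.2].
  elim: (r * L) => [|M [R HR]]; first
    by exists 0 => T chi s _; exists [::]; split; rewrite ?sub0seq.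
  have [R' HR'] := IHk R; exists R'.+1 => T chi [//|x s] /= les.
  have [c [t0 [t0s sz_t0 t0P]]] := HR' T (chi \o cons x) s les.
  have [t [tt0 sz_t tP]] : exists t : seq (T * 'I_r),
      [/\ subseq (unzip1 t) t0, size t = M & forall p y, subseq (p :: y) t ->
        size y = k -> chi (p.1 :: unzip1 y) = p.2] by apply: HR; rewrite sz_t0.
  exists ((x, c) :: t); split; rewrite /= ?eqxx ?sz_t ?(subseq_trans tt0) //.
  move=> p y; case: eqP => [->|_] /=; last exact: tP.
  move=> yt szy; apply: t0P; last by rewrite size_map.
  by apply: subseq_trans tt0; apply: map_subseq.
exists R => T chi s /HR -/(_ chi)[t [ts sz_t tP]].
have r_gt0 : 0 < r by case: (r) (chi [::]) => [[]|].
have [c leL] : exists c, L <= count (fun p => p.2 == c) t.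
  by apply: pigeonhole_count; rewrite ?sz_t.
pose t' := take L [seq p <- t | p.2 == c].
have t't : subseq t' [seq p <- t | p.2 == c] by apply: take_subseq.
exists c, (unzip1 t'); split.
- apply: subseq_trans ts; apply: map_subseq.
  exact: subseq_trans t't (filter_subseq _ _).
- by rewrite size_map size_takel // size_filter.
move=> x /subseqP[msk]; rewrite size_map => sz_m -> {x}.
rewrite -map_mask; set z := mask msk t'.
have zt' : subseq z [seq p <- t | p.2 == c].
  by apply: subseq_trans t't; apply: mask_subseq.
case: z zt' => [|p y] // pyt; rewrite size_map => -[szy].
rewrite /= tP //; last exact: subseq_trans pyt (filter_subseq _ _).
have : p \in [seq p <- t | p.2 == c] by apply: (mem_subseq pyt); rewrite mem_head.
by rewrite mem_filter => /andP[/eqP].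
Qed.
End Ramsey.

(** * Dense boxes *)

Section Boxes.

(** A weak weighted AM-GM inequality, from the first two terms of the binomial expansion of
    [(s.+1 * a + b) ^ s.+1]. It makes the maximality of a box linear. *)
Lemma leq_young (s y a b : nat) :
  y ^ s.+1 <= a ^ s * b -> s.+1 * y <= s.+1 * a + b.
Proof.
move=> le_y; rewrite -(@leq_exp2r _ _ s.+1) //.
have bern k : (s.+1 * a) ^ k.+1 + k.+1 * (s.+1 * a) ^ k * b
    <= (s.+1 * a + b) ^ k.+1.
  elim: k => [|k IHk]; first by rewrite !expn0 !expn1 !mul1n.
  rewrite [X in _ <= X]expnS; apply: leq_trans (leq_mul (leqnn _) IHk).
  by rewrite !(expnS (s.+1 * a)); nia.
apply: leq_trans (bern s); apply: leq_trans (leq_addl _ _).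
by rewrite !expnMn expnS -!mulnA !leq_mul2l le_y !orbT.
Qed.

Variables (t : nat) (W : finType) (K : {set {ffun 'I_t -> W}}).
Implicit Types X Z : {ffun 'I_t -> {set W}}.

Definition vol X := \prod_i #|X i|.
Definition mass X := #|[set u in K | [forall i, u i \in X i]]|.
Definition upd X i (Y : {set W}) : {ffun 'I_t -> {set W}} :=
  [ffun k => if k == i then Y else X k].

Lemma card_box X : #|[set u : {ffun 'I_t -> W} | [forall i, u i \in X i]]| = vol X.
Proof.
rewrite cardsE (eq_card (B := family (fun i => mem (X i)))); last by [].
by rewrite card_family foldrE big_map big_enum.
Qed.

Lemma mass_le_vol X : mass X <= vol X.
Proof.
by rewrite -card_box subset_leq_card //; apply/subsetP => u; rewrite !inE => /andP[].
Qed.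

Lemma vol_upd X i Y : vol (upd X i Y) * #|X i| = vol X * #|Y|.
Proof.
rewrite /vol (bigD1 i) //= [in RHS](bigD1 i) //= ffunE eqxx.
rewrite (eq_bigr (fun k => #|X k|)); last by move=> k /negPf nki; rewrite ffunE nki.
by rewrite mulnAC [RHS]mulnAC; congr (_ * _); apply: mulnC.
Qed.

Lemma mass_split X i (Y : {set W}) : Y \subset X i ->
  mass X = mass (upd X i Y) + mass (upd X i (X i :\: Y)).
Proof.
move=> /subsetP YX; rewrite /mass -(cardsID [set u : {ffun 'I_t -> W} | u i \in Y]).
congr (_ + _); apply: eq_card => u; rewrite !inE.
  case: (u \in K) => //=; apply/andP/forallP => [[/forallP uX uY] k|uX].
    by rewrite ffunE; case: eqP => [->|].
  split; last by have := uX i; rewrite ffunE eqxx.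
  apply/forallP => k; have := uX k; rewrite ffunE; case: eqP => // ->.
  exact: YX.
case: (u \in K); rewrite ?andbF //=.
apply/andP/forallP => [[uY /forallP uX] k|uX].
  by rewrite ffunE; case: eqP => [->|]; rewrite // !inE uY uX.
split; first by have := uX i; rewrite ffunE eqxx !inE => /andP[].
by apply/forallP => k; have := uX k; rewrite ffunE; 
  case: eqP => // ->; rewrite inE => /andP[].
Qed.

(** There are finitely many boxes, so [mass ^ s.+1 / vol ^ s] has a maximiser, and the full box
    shows that the maximum is positive. Clearing denominators covers empty boxes too. *)
Lemma maximal_box (s : nat) : 0 < #|K| -> exists X, 0 < mass X /\
  forall Z, mass Z ^ s.+1 * vol X ^ s <= mass X ^ s.+1 * vol Z ^ s.
Proof.
move=> K_gt0; pose F Z : rat := ((mass Z)%:R ^+ s.+1 / (vol Z)%:R ^+ s)%R.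
pose XT : {ffun 'I_t -> {set W}} := [ffun=> setT].
have massT : 0 < mass XT.
  case/card_gt0P: K_gt0 => u uK; apply/card_gt0P; exists u; rewrite inE uK /=.
  by apply/forallP => i; rewrite ffunE inE.
have F_gt0 Z : 0 < mass Z -> (0 < F Z)%R.
  move=> mZ; have vZ := leq_trans mZ (mass_le_vol Z).
  by rewrite divr_gt0 // exprn_gt0 // ltr0n.
have [X _ Xmax] := @Order.TotalTheory.arg_maxP _ _ _ XT xpredT F isT.
have mX : 0 < mass X.
  rewrite lt0n; apply/negP => /eqP mX; have := Xmax XT isT.
  have -> : F X = 0%R by rewrite /F mX expr0n mul0r.
  by rewrite /= leNgt F_gt0.
exists X; split=> // Z; have [->|mZ] := posnP (mass Z); first by rewrite exp0n.
have vZ := leq_trans mZ (mass_le_vol Z); have vX := leq_trans mX (mass_le_vol X).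
have := Xmax Z isT; rewrite /F /= ler_pdivrMr ?exprn_gt0 ?ltr0n // mulrAC.
rewrite ler_pdivlMr ?exprn_gt0 ?ltr0n //.
by rewrite -!natrX -!natrM ler_nat.
Qed.

(* Maximality bounds the mass of a sub-box by its share of the volume, up to an
   error [1 / s.+1]. Applied to the two boxes cut off when two sides shrink, with
   [s.+1 = 4 * E ^ 2], it leaves half of the density if each side shrinks at most
   by a factor [E]. *)
Section Regular.
Variables (s : nat) (X : {ffun 'I_t -> {set W}}).
Hypothesis mX : 0 < mass X.
Hypothesis Xmax :
  forall Z, mass Z ^ s.+1 * vol X ^ s <= mass X ^ s.+1 * vol Z ^ s.

Lemma mass_sub_box Z :
  s.+1 * (mass Z * vol X) <= s.+1 * (mass X * vol Z) + mass X * vol X.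
Proof.
(* Here [y = mass Z * vol X], [a = mass X * vol Z] and [b = mass X * vol X]. *)
apply: leq_young; have := leq_mul (Xmax Z) (leqnn (vol X)).
by rewrite !expnMn !expnS; lia.
Qed.

Let XT : {ffun 'I_t -> {set W}} := [ffun=> setT].

Let volT : vol XT = #|W| ^ t.
Proof.
rewrite /vol (eq_bigr (fun=> #|W|)) ?prod_nat_const ?card_ord // => i _.
by rewrite ffunE cardsT.
Qed.

Let massT : mass XT = #|K|.
Proof.
rewrite /mass; apply: eq_card => u; rewrite inE; case: (u \in K) => //=.
by apply/forallP => i; rewrite ffunE inE.
Qed.

Let vol_le (Y : {ffun 'I_t -> {set W}}) : (forall i, #|X i| <= #|Y i|) -> vol X <= vol Y.
Proof. by move=> XY; apply: leq_prod => i _. Qed.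

Let vX : 0 < vol X. Proof. exact: leq_trans mX (mass_le_vol X). Qed.

Let vXT : 0 < #|W| ^ t.
Proof.
by rewrite -volT; apply: leq_trans vX (vol_le _) => i; rewrite ffunE cardsT max_card.
Qed.

Let max_box_exp c : #|W| ^ t <= c * #|K| ->
  (#|W| ^ t) ^ s.+1 * vol X ^ s <= (c * mass X) ^ s.+1 * (#|W| ^ t) ^ s.
Proof.
move=> leK; apply: (@leq_trans ((c * #|K|) ^ s.+1 * vol X ^ s)).
  by rewrite leq_mul2r leq_exp2r // leK orbT.
have := Xmax XT; rewrite massT volT !(expnMn c) -!mulnA => maxT.
by rewrite leq_mul2l maxT orbT.
Qed.

(** The maximised quotient is density to the power [s.+1] times volume. The full box has the largest
    volume, so [X] is at least as dense. *)
Lemma max_box_dense c : #|W| ^ t <= c * #|K| -> vol X <= c * mass X.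
Proof.
move=> leK; rewrite -(@leq_exp2r _ _ s.+1) //.
have Ns : 0 < (#|W| ^ t) ^ s by rewrite (expn_gt0 _ s) vXT.
rewrite -(leq_pmul2r Ns); apply: leq_trans (max_box_exp leK).
rewrite !(expnS _ s) -!mulnA [X in _ <= _ * X]mulnC leq_mul2r -volT vol_le ?orbT // => i.
by rewrite ffunE cardsT max_card.
Qed.

(** Comparison with the full box and [mass X <= vol X] give [#|W| ^ t <= c ^ s.+1 * vol X].
    Enlarging all sides but the [i]-th to [W] then bounds that side. *)
Lemma max_box_large c i : #|W| ^ t <= c * #|K| -> #|W| <= c ^ s.+1 * #|X i|.
Proof.
move=> leK; have Nv : 0 < (#|W| ^ t) ^ s * vol X ^ s.
  by rewrite muln_gt0 !(expn_gt0 _ s) vXT vX.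
have leN : #|W| ^ t <= c ^ s.+1 * vol X.
  rewrite -(leq_pmul2r Nv) mulnA -expnS; apply: leq_trans (max_box_exp leK) _.
  rewrite expnMn mulnC [X in _ <= X]mulnCA leq_mul2l -!mulnA leq_mul2l -expnS.
  by rewrite leq_exp2r // mass_le_vol !orbT.
have := vol_upd XT i (X i); rewrite ffunE cardsT volT => volE.
rewrite -(leq_pmul2l vXT) [X in _ <= X]mulnCA -volE mulnA leq_mul2r.
rewrite (leq_trans leN) ?orbT // leq_mul2l vol_le ?orbT // => k.
by rewrite !ffunE; case: eqP => [->|]; rewrite // cardsT max_card.
Qed.

Lemma max_box_regular E i j (B C : {set W}) : s.+1 = 4 * E ^ 2 -> i != j ->
  B \subset X i -> C \subset X j -> #|X i| <= E * #|B| -> #|X j| <= E * #|C| ->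
  mass X * (#|B| * #|C|) <=
    2 * (mass (upd (upd X i B) j C) * (#|X i| * #|X j|)).
Proof.
move=> sE nij BX CX leB leC; pose XB := upd X i B.
have XBj : XB j = X j by rewrite ffunE eq_sym (negPf nij).
have := mass_split BX; have : mass XB = _ := @mass_split XB j C _; rewrite XBj.
move=> /(_ CX); have := mass_sub_box (upd X i (X i :\: B)).
have := mass_sub_box (upd XB j (X j :\: C)).
have := vol_upd X i (X i :\: B); have := vol_upd X i B; rewrite -/XB.
have := vol_upd XB j (X j :\: C); rewrite XBj.
have := cardsID B (X i); have := cardsID C (X j).
rewrite (setIidPr BX) (setIidPr CX).
move: #|X i| #|X j| #|B| #|C| (#|_ :\: _|) (#|_ :\: _|) leB leC.
move=> xi xj b c b' c' leB leC.
move: (mass (upd X i _)) (mass (upd XB j _)) (mass (upd XB j C)) (mass XB).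
move=> m1 m2 mBC mB.
move: (vol (upd X i _)) (vol (upd XB j _)) (vol XB) => v1 v2 vB.
move: (mass X) (vol X) vX => e v v_gt0 cE bE v2E vBE v1E le2 le1 mBE eE.
have := ltn0Sn s; move: s.+1 sE le1 le2 => S sE le1 le2 S_gt0.
have {}le1 : S * (m1 * xi) <= S * (e * b') + e * xi.
  rewrite -(leq_pmul2r v_gt0); have := leq_mul le1 (leqnn xi).
  have -> : (S * (e * v1) + e * v) * xi = S * e * (v1 * xi) + e * v * xi by lia.
  rewrite v1E; lia.
have {}le2 : S * (m2 * (xi * xj)) <= S * (e * (b * c')) + e * (xi * xj).
  rewrite -(leq_pmul2r v_gt0); have := leq_mul le2 (leqnn (xi * xj)).
  have -> : (S * (e * v2) + e * v) * (xi * xj) =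
    S * e * (v2 * xj * xi) + e * v * (xi * xj) by lia.
  have -> : v2 * xj * xi = vB * xi * c' by rewrite v2E; lia.
  rewrite vBE; lia.
have le_u : xi * xj <= E ^ 2 * (b * c).
  by apply: leq_trans (leq_mul leB leC) _; rewrite expnS expn1; lia.
have E_gt0 : 0 < E ^ 2 by rewrite lt0n; apply: contraTneq S_gt0 => E0; rewrite sE E0.
(* The two boxes cut off cost an error of [2 * e * (xi * xj)], at most half of [S * (e * (b * c))]
   since [xi * xj <= E ^ 2 * (b * c)] and [S = 4 * E ^ 2]. *)
have le3 : S * (e * (b * c)) <= S * (mBC * (xi * xj)) + 2 * e * (xi * xj).
  have := leq_mul le1 (leqnn xj); rewrite -bE -cE eE mBE in le2 *; lia.
have le4 := leq_mul (leqnn (2 * e)) le_u.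
rewrite -(leq_pmul2l E_gt0); move: (E ^ 2) sE le4 le3 => F -> le4 le3; lia.
Qed.
End Regular.

(** Project to the coordinates [i] and [j]: the image consists of [G]-pairs, and each fibre lies in
    a box of volume [vol X / (#|X i| * #|X j|)]. *)
Lemma mass_pairs (G : rel W) X i j (B C : {set W}) : i != j ->
  (forall u, u \in K -> G (u i) (u j)) ->
  mass (upd (upd X i B) j C) * (#|X i| * #|X j|) <=
    vol X * \sum_(w in B) #|[set y in C | G w y]|.
Proof.
move=> nij KG; pose P := [set p : W * W | [&& p.1 \in B, p.2 \in C & G p.1 p.2]].
have -> : \sum_(w in B) #|[set y in C | G w y]| = #|P|.
  rewrite -sum1_card (eq_bigr (fun w => \sum_(y | (y \in C) && G w y) 1)).
    rewrite pair_big_dep; apply: eq_bigl => -[w y]; rewrite inE /=.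
    by [].
  by move=> w _; rewrite -sum1_card; apply: eq_bigl => y; rewrite inE.
rewrite /mass -sum1_card.
rewrite (partition_big (fun u : {ffun 'I_t -> W} => (u i, u j)) (mem P)) /=; last first.
  move=> u; rewrite !inE => /andP[/KG -> /forallP uZ]; rewrite andbT.
  apply/andP; split; last by have := uZ j; rewrite ffunE eqxx.
  by have := uZ i; rewrite !ffunE eqxx (negPf nij).
rewrite big_distrl [X in _ <= X]mulnC -[X in _ <= X]sum_nat_const /=.
apply: leq_sum => -[w y] _ /=.
pose Z := upd (upd X i [set w]) j [set y].
apply: (@leq_trans (vol Z * (#|X i| * #|X j|))); last first.
  have := vol_upd (upd X i [set w]) j [set y]; have := vol_upd X i [set w].
  rewrite !cards1 !muln1 ffunE eq_sym (negPf nij) -/Z => h1 h2.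
  by rewrite -h1 -h2 -mulnA [#|X i| * _]mulnC.
rewrite leq_mul2r -card_box sum1_card subset_leq_card ?orbT //.
apply/subsetP => u; rewrite unfold_in /= !inE => /andP[/andP[_ /forallP uZ] /eqP[wE yE]].
apply/forallP => k; have := uZ k; rewrite !ffunE.
case: eqP => [->|_]; first by rewrite inE yE.
by case: eqP => [->|_]; rewrite // inE wE.
Qed.

End Boxes.

(** If the exceptional words filled a [1 / E] share of [X i], shrinking side [i] to them and side
    [j] to [C] would keep density at least [1 / (2 * c)]. By [mass_pairs] their average number of
    neighbours in [C] would then be too large. *)
Lemma regular_boxes (t : nat) (W : finType) (K : {set {ffun 'I_t -> W}})
    (G : 'I_t -> 'I_t -> rel W) (c E : nat) :
  0 < #|W| -> 0 < E -> #|W| ^ t <= c * #|K| ->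
  (forall u i j, u \in K -> i != j -> G i j (u i) (u j)) ->
  exists X : 'I_t -> {set W}, (forall i, #|W| <= c ^ (4 * E ^ 2) * #|X i|) /\
    forall i j (C : {set W}), i != j -> C \subset X j -> #|X j| <= E * #|C| ->
    E * #|[set w in X i | 2 * c * #|[set y in C | G i j w y]| < #|C|]| < #|X i|.
Proof.
move=> W_gt0 E_gt0 leK KG.
have [s sE] : exists s, s.+1 = 4 * E ^ 2.
  by exists (4 * E ^ 2).-1; rewrite prednK // muln_gt0 expn_gt0 E_gt0.
have K_gt0 : 0 < #|K|.
  rewrite lt0n; apply: contraTneq leK => ->.
  by rewrite muln0 leqn0 -lt0n expn_gt0 W_gt0.
have [X [mX Xmax]] := maximal_box s K_gt0.
have X_large i : #|W| <= c ^ (4 * E ^ 2) * #|X i|.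
  by rewrite -sE; exact: (max_box_large mX Xmax i leK).
exists X; split=> // i j C nij CX leC.
set B := [set w in X i | _]; rewrite ltnNge; apply/negP => leB.
have BX : B \subset X i by apply/subsetP => w; rewrite inE => /andP[].
have := max_box_regular mX Xmax sE nij BX CX leB leC.
have := @mass_pairs _ _ K (G i j) X i j B C nij (fun u uK => KG u i j uK nij).
have := max_box_dense mX Xmax leK.
have : 2 * c * \sum_(w in B) #|[set y in C | G i j w y]| < #|B| * #|C|.
  have B_gt0 : 0 < #|B|.
    have := leq_trans W_gt0 (X_large i); rewrite muln_gt0 => /andP[_ Xi].
    by have := leq_trans Xi leB; rewrite muln_gt0 => /andP[].
  have [w0 w0B] := card_gt0P B_gt0.
  rewrite big_distrr -sum_nat_const /= (bigD1 w0) //= [X in _ < X](bigD1 w0) //=.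
  rewrite -addSn leq_add ?leq_sum //; first by have := w0B; rewrite inE => /andP[].
  by move=> w /andP[]; rewrite inE => /andP[_ /ltnW].
have v_gt0 := leq_trans mX (mass_le_vol K X).
move: (\sum_(w in B) _) (mass K (upd _ j C)) (mass K X) (vol X) v_gt0 => S m M v v0.
move: #|B| #|C| #|X i| #|X j| => b d x y ltS leM lem lebd.
have : v * (b * d) <= v * (2 * c * S).
  have h1 := leq_mul leM (leqnn (b * d)); have h2 := leq_mul (leqnn c) lebd.
  have h3 := leq_mul (leqnn (2 * c)) lem.
  by apply: leq_trans h1 _; lia.
by rewrite leq_pmul2l // leqNgt ltS.
Qed.

(** * Distance-two colourings and agreement of words *)

Section Colouring.

Lemma leq_card_bigcup (I T : finType) (P : pred I) (F : I -> {set T}) :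
  #|\bigcup_(i | P i) F i| <= \sum_(i | P i) #|F i|.
Proof.
elim/big_rec2: _ => [|i n A _ leA]; first by rewrite cards0.
by apply: leq_trans (leq_add (leqnn _) leA); apply: leq_card_setU.
Qed.

Lemma greedy_colouring (T : finType) (e : rel T) (d : nat) : symmetric e ->
  (forall x, #|[set y | e x y]| <= d) ->
  exists f : T -> 'I_d.+1, forall x y, e x y -> x != y -> f x != f y.
Proof.
move=> e_sym e_deg.
suff /(_ (enum T))[f fP] : forall s : seq T, exists f : T -> 'I_d.+1,
    {in s &, forall x y, e x y -> x != y -> f x != f y}.
  by exists f => x y; apply: fP; rewrite mem_enum.
elim=> [|z s [f fP]]; first by exists (fun=> ord0).
have [c cP] : exists c, c \notin f @: [set y | e z y].
  apply/existsP; apply: contraT => /existsPn fT.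
  have : #|'I_d.+1| <= #|f @: [set y | e z y]|.
    by apply/subset_leq_card/subsetP => c _; move: (fT c); rewrite negbK.
  rewrite card_ord => /leq_trans/(_ (leq_imset_card _ _)).
  by move=> /leq_trans/(_ (e_deg z)); rewrite ltnn.
have cN y : e z y -> c != f y.
  by move=> ezy; apply: contraNneq cP => ->; rewrite imset_f // inE.
exists (fun x => if x == z then c else f x) => x y; rewrite !inE.
case: (eqVneq x z) => [->|nxz]; case: (eqVneq y z) => [->|nyz] //= xs ys.
- by move=> /cN.
- by rewrite e_sym [f x == c]eq_sym => /cN.
exact: fP.
Qed.

(** Greedy colouring of the square of [H], whose degrees are at most [D + D * D]. *)
Lemma distance2_colouring (H : sgraph) (D : nat) : max_degree H <= D ->
  exists f : H -> 'I_(D + D * D).+1,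
    (forall x y, adj x y -> f x != f y) /\
    forall z x y, adj z x -> adj z y -> f x = f y -> x = y.
Proof.
move=> degH; have deg (x : H) : #|[set y | adj x y]| <= D.
  exact: leq_trans (leq_bigmax x) degH.
pose e (x y : H) := adj x y || [exists z, adj x z && adj z y].
have [||f fP] := @greedy_colouring H e (D + D * D).
- move=> x y; rewrite /e adj_sym; congr (_ || _).
  by apply: eq_existsb => z; rewrite andbC adj_sym [X in _ && X]adj_sym.
- move=> x; have /subset_leq_card : [set y | e x y] \subset [set y | adj x y] :|:
      \bigcup_(z in [set z | adj x z]) [set y | adj z y].
    apply/subsetP => y; rewrite !inE => /orP[->//|/existsP[z /andP[xz zy]]].
    by apply/orP; right; apply/bigcupP; exists z; rewrite inE.
  move=> /leq_trans; apply; apply: leq_trans (leq_card_setU _ _) _.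
  rewrite leq_add //; apply: leq_trans (leq_card_bigcup _ _) _.
  apply: (@leq_trans (\sum_(z in [set z | adj x z]) D)); first exact: leq_sum.
  by rewrite sum_nat_const leq_mul2r deg orbT.
exists f; split=> [x y xy|z x y zx zy fxy].
  by apply: fP; rewrite /e ?xy //; apply: contraTneq xy => ->; rewrite adj_irrefl.
apply/eqP; apply: contra_eqT fxy => nxy; apply: fP nxy.
by apply/orP; right; apply/existsP; exists z; rewrite adj_sym zx.
Qed.
End Colouring.

Section Agreement.
Variables q m : nat.
Local Notation W := {ffun 'I_q -> 'I_m}.

Definition agree (P : {set 'I_q}) (x y : W) := [forall a in P, x a == y a].

Lemma agree_sym P : symmetric (agree P).
Proof. by move=> x y; apply: eq_forallb => a /=; rewrite eq_sym. Qed.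

Lemma agree_trans P : transitive (agree P).
Proof.
move=> y x z /forall_inP xy /forall_inP yz; apply/forall_inP => a aP.
by rewrite (eqP (xy a aP)) yz.
Qed.

Lemma card_agree P x : #|[set y | agree P x y]| = m ^ #|~: P|.
Proof.
rewrite cardsE (eq_card (B := family (fun a => if a \in P then pred1 (x a) else predT))).
  rewrite card_family foldrE big_map big_enum /= (bigID (mem P)) /=.
  rewrite big1 ?mul1n => [|a aP]; last by rewrite aP card1.
  rewrite (eq_bigr (fun=> m)) => [|a aP]; last by rewrite (negPf aP) card_ord.
  by rewrite prod_nat_const; congr (_ ^ _); apply: eq_card => a; rewrite !inE.
move=> y; rewrite unfold_in; apply: eq_forallb => a.
by case aP: (a \in P); rewrite /= aP ?inE //= eq_sym.
Qed.

(** Double counting: each [g] is counted once for every word in its cell. *)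
Lemma card_agree_sum P (H : finType) (phi : H -> W) (S : {set H}) :
  \sum_w #|[set g in S | agree P w (phi g)]| = #|S| * m ^ #|~: P|.
Proof.
under eq_bigr do rewrite -sum1_card.
rewrite (exchange_big_dep (mem S)) /=; last by move=> w g _; rewrite inE => /andP[].
rewrite -sum_nat_const; apply: eq_bigr => g gS.
rewrite sum1_card -(card_agree P (phi g)); apply: eq_card => w.
by rewrite -[LHS]/(g \in [set g in S | agree P w (phi g)]) !inE gS agree_sym.
Qed.

End Agreement.

(** * Greedy embedding *)

Section Embedding.
Variables q m t : nat.
Local Notation W := {ffun 'I_q -> 'I_m}.
Variables (G : 'I_t -> 'I_t -> rel W) (X : 'I_t -> {set W}) (H : sgraph).
Variable f : H -> 'I_t.
(** [1 / A] is the share of its candidates that a vertex keeps when a neighbour is placed, [1 / E]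
    bounds the share of exceptional words, [1 / c] that of a side among all words, and [b] limits
    how full a cell of words may get. *)
Variables (A E b c D : nat).
Hypothesis G_sym : forall i j x y, G i j x y = G j i y x.
Hypothesis X_large : forall i, m ^ q <= c * #|X i|.
Hypothesis X_regular : forall i j (C : {set W}), i != j -> C \subset X j ->
  #|X j| <= E * #|C| ->
  E * #|[set w in X i | A * #|[set y in C | G i j w y]| < #|C|]| < #|X i|.
Hypothesis f_adj : forall x y, adj x y -> f x != f y.
Hypothesis f_dist2 : forall z x y, adj z x -> adj z y -> f x = f y -> x = y.
Hypothesis degH : max_degree H <= D.
Hypotheses (A_gt0 : 0 < A) (D_gt0 : 0 < D) (c_gt0 : 0 < c).
Hypothesis E_large : D * (4 * A ^ D) <= E.
Hypothesis b_large : D * 2 ^ q * (4 * A ^ D * c) <= b.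
Hypothesis m_large : 2 * b <= m.
Hypothesis mq_large : (#|H| + 2 ^ q * (2 * b * #|H|)) * (4 * A ^ D * c) <= m ^ q.

Implicit Types (S : {set H}) (phi : H -> W) (P : {set 'I_q}).

Definition candidates S phi h :=
  [set w in X (f h) | [forall g in S, adj h g ==> G (f h) (f g) w (phi g)]].

Definition class_in S phi i P z := [set g in S | (f g == i) && agree P z (phi g)].

(** The invariant of the greedy embedding. In [pe_disjoint], [P] stands for the positions of a
    common suffix of the starts and [~: P] for those of a common prefix of the ends; the excluded
    values of [P] belong to path ends. Allowing all other [P] makes the condition symmetric in start
    and end. *)
Record partial_embedding S phi : Prop := PartialEmbedding {
  pe_adj : forall h g, h \in S -> g \in S -> adj h g ->
    G (f h) (f g) (phi h) (phi g);
  pe_cand : forall h, h \notin S ->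
    #|X (f h)| <= A ^ #|[set g in S | adj h g]| * #|candidates S phi h|;
  pe_spread : forall i P z, P != setT ->
    b * #|class_in S phi i P z| <= m ^ #|~: P|;
  pe_inj : forall h g, h \in S -> g \in S -> f h = f g -> phi h = phi g -> h = g;
  pe_disjoint : forall h h' g g' P, h \in S -> h' \in S -> g \in S -> g' \in S ->
    adj h h' -> adj g g' -> f h = f g -> f h' = f g' -> P != set0 -> P != setT ->
    agree P (phi h) (phi g) -> agree (~: P) (phi h') (phi g') -> h = g }.

Let deg (h : H) : #|[set g | adj h g]| <= D.
Proof. exact: leq_trans (leq_bigmax h) degH. Qed.

Let m_gt0 : 0 < m.
Proof.
apply: leq_trans m_large; rewrite muln_gt0 /=; apply: leq_trans b_large.
by rewrite !muln_gt0 D_gt0 c_gt0 !expn_gt0 A_gt0.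
Qed.

Let X_gt0 i : 0 < #|X i|.
Proof.
have := X_large i; case: posnP => // ->; rewrite muln0 leqn0.
by rewrite expn_eq0 (gtn_eqF m_gt0).
Qed.

Let A_exp k : k <= D -> A ^ k <= A ^ D.
Proof. by move=> kD; case: (A) A_gt0 => // a _; rewrite leq_pexp2l. Qed.

Let card_sets : #|{: {set 'I_q}}| = 2 ^ q.
Proof. by rewrite -cardsT -powersetT card_powerset cardsT card_ord. Qed.

Section Step.
Variables (S : {set H}) (phi : H -> W) (h : H).
Hypothesis pe : partial_embedding S phi.
Hypothesis hS : h \notin S.

Let used := [set phi g | g in S].

(* Adding one more vertex to the cell of [w] would make that cell too full. *)
Let crowded := \bigcup_(P : {set 'I_q} | P != setT)
  [set w | m ^ #|~: P| < b * #|class_in S phi (f h) P w|.+1].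

(* The path from [w] to [phi h'] would meet the path from [phi g] to [phi g']. *)
Let crossing h' P := \bigcup_(g' in class_in S phi (f h') (~: P) (phi h'))
  \bigcup_(g in [set g | [&& g \in S, adj g' g & f g == f h]])
    [set w | agree P (phi g) w].
Let crossings := \bigcup_(h' in [set h' in S | adj h h'])
  \bigcup_(P : {set 'I_q} | P != set0) crossing h' P.

(** Placing [h] on such a word would leave [h'] less than a [1 / A] share of its candidates. *)
Let isolated h' := [set w in X (f h) | A * #|[set y in candidates S phi h' |
  G (f h) (f h') w y]| < #|candidates S phi h'|].
Let starving := \bigcup_(h' in [set h' | (h' \notin S) && adj h h']) isolated h'.

Let card_used : #|used| <= #|H|.
Proof. exact: leq_trans (leq_imset_card _ _) (max_card _). Qed.

(** As [2 * b <= m], a cell that is full up to one vertex already holds more than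
    [m ^ #|~: P| / (2 * b)] vertices. Summing over all words with [card_agree_sum] bounds the
    crowded ones. *)
Let card_crowded : #|crowded| <= 2 ^ q * (2 * b * #|H|).
Proof.
apply: leq_trans (leq_card_bigcup _ _) _.
apply: (@leq_trans (\sum_(P : {set 'I_q}) 2 * b * #|H|)); last first.
  by rewrite sum_nat_const card_sets.
rewrite big_mkcond leq_sum // => P _; case: ifP => // PT.
have m_P : m <= m ^ #|~: P|.
  have : 0 < #|~: P| by rewrite card_gt0 -setCT (inj_eq (@setC_inj _)).
  by case: #|~: P| => // k _; rewrite expnS leq_pmulr // expn_gt0 m_gt0.
have mP_gt0 : 0 < m ^ #|~: P| by rewrite expn_gt0 m_gt0.
rewrite -(leq_pmul2r mP_gt0) -sum_nat_const.
apply: (@leq_trans (\sum_w 2 * b * #|[set g in S | agree P w (phi g)]|)).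
  rewrite big_mkcond leq_sum // => w _; case: ifP; rewrite // inE => full.
  have le_k : #|class_in S phi (f h) P w| <= #|[set g in S | agree P w (phi g)]|.
    by apply/subset_leq_card/subsetP => g; rewrite !inE => /and3P[-> _ ->].
  have := leq_mul (leqnn b) le_k; have := leq_trans m_large m_P.
  by move: full; rewrite mulnS; lia.
by rewrite -big_distrr /= card_agree_sum mulnA leq_mul2r leq_mul2l max_card !orbT.
Qed.

(** By [pe_spread] there are at most [m ^ #|P| / b] choices of [g']; each has at most one neighbour
    [g] in the class of [h], which blocks [m ^ #|~: P|] words. *)
Let card_crossing h' P : P != set0 -> b * #|crossing h' P| <= m ^ q.
Proof.
move=> P0; have PT : ~: P != setT by rewrite -setC0 (inj_eq (@setC_inj _)).
have mqE : m ^ #|P| * m ^ #|~: P| = m ^ q by rewrite -expnD cardsC card_ord.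
have := pe_spread pe (f h') (phi h') PT; rewrite setCK => spread.
rewrite -mqE; apply: leq_trans (leq_mul spread (leqnn _)).
rewrite -mulnA leq_mul2l; apply/orP; right.
apply: leq_trans (leq_card_bigcup _ _) _; rewrite -sum_nat_const.
apply: leq_sum => g' _; apply: leq_trans (leq_card_bigcup _ _) _.
rewrite (eq_bigr (fun=> m ^ #|~: P|)) => [|g _]; last exact: card_agree.
rewrite sum_nat_const -[X in _ <= X]mul1n leq_mul2r; apply/orP; right.
apply/card_le1_eqP => g1 g2; rewrite !inE.
move=> /and3P[_ a1 /eqP f1] /and3P[_ a2 /eqP f2].
by apply: f_dist2 a2 a1 _; rewrite f1.
Qed.

Let card_crossings : b * #|crossings| <= D * 2 ^ q * m ^ q.
Proof.
apply: (@leq_trans (\sum_(h' in [set h' in S | adj h h']) 2 ^ q * m ^ q)).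
  apply: leq_trans (leq_mul (leqnn b) (leq_card_bigcup _ _)) _.
  rewrite big_distrr /= leq_sum // => h' _.
  apply: leq_trans (leq_mul (leqnn b) (leq_card_bigcup _ _)) _.
  rewrite big_distrr /= big_mkcond /=.
  rewrite -card_sets -sum_nat_const.
  by apply: leq_sum => P _; case: ifP => // P0; apply: card_crossing.
rewrite sum_nat_const -mulnA leq_mul2r; apply/orP; right.
apply: leq_trans (deg h); apply/subset_leq_card/subsetP => g.
by rewrite !inE => /andP[].
Qed.

(** Regularity applies with [C] the candidates of [h'], a share of at least [A ^ - D], hence at
    least [1 / E], of their side. *)
Let card_starving : E * #|starving| <= D * #|X (f h)|.
Proof.
apply: leq_trans (leq_mul (leqnn E) (leq_card_bigcup _ _)) _.
rewrite big_distrr /=.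
apply: (@leq_trans (\sum_(h' in [set h' | (h' \notin S) && adj h h']) #|X (f h)|)).
  apply: leq_sum => h'; rewrite inE => /andP[h'S hh']; apply/ltnW/X_regular.
  - exact: f_adj.
  - by apply/subsetP => w; rewrite inE => /andP[].
  apply: leq_trans (pe_cand pe h'S) _; rewrite leq_mul2r; apply/orP; right.
  have /A_exp : #|[set g in S | adj h' g]| <= D.
    apply: leq_trans (deg h'); apply/subset_leq_card/subsetP => g.
    by rewrite !inE => /andP[].
  move=> /leq_trans; apply; apply: leq_trans E_large.
  by rewrite mulnA leq_pmull // muln_gt0 D_gt0.
rewrite sum_nat_const leq_mul2r; apply/orP; right.
apply: leq_trans (deg h); apply/subset_leq_card/subsetP => g.
by rewrite !inE => /andP[].
Qed.

Let bad := used :|: crowded :|: crossings :|: starving.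

(** At least [#|X (f h)| / A ^ D] candidates remain. Used and crowded words together, crossings, and
    starving words each take at most a quarter of this number, by [mq_large], [b_large] and
    [E_large]. *)
Let good_candidate : exists2 w, w \in candidates S phi h & w \notin bad.
Proof.
suff /subsetPn[w] : ~~ (candidates S phi h \subset bad) by exists w.
apply: contraTN isT => /subset_leq_card le_bad.
have cand : #|X (f h)| <= A ^ D * #|candidates S phi h|.
  apply: leq_trans (pe_cand pe hS) _; rewrite leq_mul2r A_exp ?orbT //.
  apply: leq_trans (deg h); apply/subset_leq_card/subsetP => g.
  by rewrite !inE => /andP[].
have le_bad4 : #|bad| <= #|used| + #|crowded| + #|crossings| + #|starving|.
  by do 3?[apply: leq_trans (leq_card_setU _ _) _; rewrite leq_add2r].
have Xc := X_large (f h); have X0 := X_gt0 (f h).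
have mq0 : 0 < m ^ q by rewrite expn_gt0 m_gt0.
have b0 : 0 < b.
  by apply: leq_trans b_large; rewrite !muln_gt0 D_gt0 c_gt0 !expn_gt0 A_gt0.
have AD0 : 0 < A ^ D by rewrite expn_gt0 A_gt0.
have E0 : 0 < E by apply: leq_trans E_large; rewrite !muln_gt0 D_gt0 AD0.
have le1 : (#|used| + #|crowded|) * (4 * A ^ D) <= #|X (f h)|.
  rewrite -(leq_pmul2l c_gt0); apply: leq_trans Xc; apply: leq_trans mq_large.
  by rewrite mulnC -mulnA leq_mul // leq_add.
have le2 : 4 * A ^ D * #|crossings| <= #|X (f h)|.
  rewrite -(leq_pmul2l b0); apply: leq_trans (leq_mul b_large (leqnn _)).
  have h1 := leq_mul card_crossings (leqnn (4 * A ^ D)).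
  have h2 := leq_mul (leqnn (D * 2 ^ q * (4 * A ^ D))) Xc.
  rewrite mulnCA mulnC; apply: leq_trans h1 _.
  by apply: leq_trans (leq_trans _ h2) _; lia.
have le3 : 4 * A ^ D * #|starving| <= #|X (f h)|.
  rewrite -(leq_pmul2l E0); apply: leq_trans (leq_mul E_large (leqnn _)).
  have h1 := leq_mul card_starving (leqnn (4 * A ^ D)).
  by rewrite mulnCA mulnC; apply: leq_trans h1 _; lia.
move: (A ^ D) #|X (f h)| #|used| #|crowded| #|crossings| #|starving|
  #|candidates _ _ _| #|bad| => a x n1 n2 n3 n4 k l in
  cand X0 le1 le2 le3 le_bad le_bad4 *; nia.
Qed.

Lemma extend_embedding : exists phi', partial_embedding (h |: S) phi'.
Proof.
have [w wc] := good_candidate; rewrite !inE !negb_or => /andP[/andP[/andP[wU wC] wX] wS].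
pose phi' g := if g == h then w else phi g; exists phi'.
have phi'h : phi' h = w by rewrite /phi' eqxx.
have neqh g : g \in S -> (g == h) = false.
  by move=> gS; apply: contraNF hS => /eqP <-.
have phi'S g : g \in S -> phi' g = phi g by move=> /neqh gh; rewrite /phi' gh.
have [wXh /forall_inP wG] : w \in X (f h) /\
    [forall g in S, adj h g ==> G (f h) (f g) w (phi g)].
  by move: wc; rewrite inE => /andP.
have cross h' g g' P : h' \in S -> g \in S -> g' \in S -> adj h h' ->
    adj g g' -> f h = f g -> f h' = f g' -> P != set0 ->
    agree P (phi g) w -> agree (~: P) (phi h') (phi g') -> False.
  move=> h'S gS g'S hh' gg' fg fg' P0 aP aP'; case/negP: wX.
  apply/bigcupP; exists h'; first by rewrite inE h'S.
  apply/bigcupP; exists P => //; apply/bigcupP; exists g'.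
    by rewrite inE g'S fg' eqxx.
  by apply/bigcupP; exists g; rewrite !inE // gS adj_sym gg' fg eqxx.
split=> [g g'|g|i P z PT|g g'|g g' k k' P].
- rewrite !inE => /predU1P[->|gS] /predU1P[->|g'S]; rewrite ?phi'h ?phi'S //.
  + by rewrite adj_irrefl.
  + by move=> hg'; have /implyP -> := wG _ g'S.
  + by rewrite adj_sym G_sym => hg; have /implyP -> := wG _ gS.
  exact: (pe_adj pe).
- rewrite !inE negb_or => /andP[ngh gS].
  have cE : candidates (h |: S) phi' g = [set y in candidates S phi g |
      adj h g ==> G (f h) (f g) w y].
    apply/setP => y; rewrite !inE -andbA; congr (_ && _).
    apply/forall_inP/andP => [yG|[/forall_inP yG yh] k].
      split; last by have := yG h; rewrite setU11 phi'h adj_sym G_sym => ->.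
      apply/forall_inP => k kS; have := yG k; rewrite phi'S // => -> //.
      by rewrite !inE kS orbT.
    rewrite !inE => /predU1P[->|kS]; first by rewrite phi'h adj_sym G_sym.
    by rewrite phi'S //; apply: yG.
  have dE : [set k in h |: S | adj g k] =
      (if adj h g then [set h] else set0) :|: [set k in S | adj g k].
    apply/setP => k; rewrite !inE andb_orl; congr (_ || _).
    case: eqP => [->|nkh]; rewrite /= 1?adj_sym; case: ifP; rewrite !inE ?eqxx //.
    by move/eqP: nkh => /negPf ->.
  rewrite cE dE; have le_c := pe_cand pe gS.
  case hg: (adj h g) => /=.
    rewrite cardsU1 !inE (negPf hS) /= add1n expnSr -mulnA.
    apply: leq_trans le_c _; rewrite leq_mul2l; apply/orP; right.
    rewrite leqNgt; apply/negP => lt_c; case/negP: wS.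
    by apply/bigcupP; exists g; rewrite !inE ?gS ?hg // wXh.
  rewrite set0U; apply: leq_trans le_c _; rewrite leq_mul2l subset_leq_card ?orbT //.
  by apply/subsetP => y; rewrite !inE andbT.
- have class_S : class_in (h |: S) phi' i P z :\ h \subset class_in S phi i P z.
    apply/subsetP => g; rewrite !inE => /andP[/negPf ngh /andP[]].
    by rewrite ngh /phi' ngh /= => ->.
  case zh : (h \in class_in (h |: S) phi' i P z); last first.
    apply: leq_trans (pe_spread pe i z PT); rewrite leq_mul2l.
    apply/orP; right; apply/subset_leq_card/(subset_trans _ class_S).
    by rewrite subsetD1 subxx zh.
  (* If [h] joins the cell of [z], this is also the cell of [w], which is not crowded. *)
  move: zh; rewrite !inE eqxx phi'h /= => /andP[/eqP fi az].
  have : m ^ #|~: P| < b * #|class_in S phi (f h) P w|.+1 = false.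
    apply: contraNF wC => full; apply/bigcupP; exists P => //.
    by rewrite inE.
  move/negbT; rewrite -leqNgt; apply: leq_trans; rewrite leq_mul2l; apply/orP; right.
  rewrite (cardsD1 h) -(add1n #|class_in S _ _ _ _|) leq_add ?leq_b1 //.
  apply: leq_trans (subset_leq_card class_S) _; apply/subset_leq_card/subsetP => g.
  rewrite !inE fi => /and3P[-> -> zg]; apply: agree_trans zg.
  by rewrite agree_sym.
- have inj k : k \in S -> phi k <> w.
    by move=> kS kw; case/negP: wU; rewrite -kw imset_f.
  rewrite !inE => /predU1P[->|gS] /predU1P[->|g'S] //; rewrite ?phi'h ?phi'S //.
  + by move=> _ /esym/inj -/(_ g'S).
  + by move=> _ /inj -/(_ gS).
  exact: (pe_inj pe).
have nadj x y : adj x y -> f x = f y -> False.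
  by move=> /f_adj/eqP.
have CC0 Q : Q != setT -> ~: Q != set0 by rewrite -setCT (inj_eq (@setC_inj _)).
(* If only one edge contains [h], then [cross] applies, with [P] complemented when [h] is the end.
   If both do, either adjacent vertices would share a class, or the edges have the common end [h]
   and [f_dist2] identifies their starts. *)
rewrite !inE => /predU1P[->|gS] /predU1P[->|g'S] /predU1P[->|kS] /predU1P[->|k'S] //;
  rewrite ?adj_irrefl // ?phi'h ?phi'S // => ag ak fk fk' P0 PT aP aP'.
- by case: (nadj _ _ ak).
- by case: (cross g' k k' P); rewrite // agree_sym.
- by case: (nadj _ _ ag).
- by apply: f_dist2 fk; rewrite adj_sym; [apply: ag | apply: ak].
- by case: (cross g k' k (~: P)); rewrite ?setCK ?CC0 // 1?adj_sym // agree_sym.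
- by case: (cross k' g g' P); rewrite // agree_sym.
- by case: (cross k g' g (~: P)); rewrite ?setCK ?CC0 // 1?adj_sym // agree_sym.
exact: (pe_disjoint pe gS g'S kS k'S ag ak fk fk' P0 PT aP aP').
Qed.

End Step.

Lemma full_embedding : exists phi, partial_embedding setT phi.
Proof.
suff /(_ #|H| (leqnn _))[S [phi [cS pe]]] : forall k, k <= #|H| ->
    exists S phi, #|S| = k /\ partial_embedding S phi.
  by exists phi; have /eqP <- : S == setT by rewrite eqEcard subsetT cardsT cS /=.
elim=> [_|k IHk ltk].
  have W_gt0 : 0 < #|{: W}| by rewrite card_ffun !card_ord expn_gt0 m_gt0.
  have [w _] := card_gt0P W_gt0; exists set0, (fun=> w); split; first exact: cards0.
  split=> [h g|h _|i P z PT|h g|h h' g g' P]; rewrite ?inE //.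
    apply: (@leq_trans (1 * #|candidates set0 (fun=> w) h|)); last first.
      by rewrite leq_mul2r expn_gt0 A_gt0 orbT.
    rewrite mul1n; apply/subset_leq_card/subsetP => y yX; rewrite inE yX.
    by apply/forall_inP => g; rewrite inE.
  rewrite (_ : class_in _ _ _ _ _ = set0) ?cards0 ?muln0 //.
  by apply/setP => g; rewrite !inE.
have [S [phi [cS pe]]] := IHk (ltnW ltk).
have [h hS] : exists h, h \notin S.
  apply/existsP; apply: contraTT ltk => /existsPn ST; rewrite -leqNgt -cS.
  by apply/subset_leq_card/subsetP => h _; move: (ST h); rewrite negbK.
have [phi' pe'] := extend_embedding pe hS.
by exists (h |: S), phi'; rewrite cardsU1 hS cS.
Qed.

End Embedding.

(** * The de Bruijn graph *)

Section DeBruijn.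
Variables (q : nat) (L : finType).
Local Notation V := {ffun 'I_q.+1 -> L}.

(** Words have length [q.+1], which is also the length of the paths. *)
Definition shift (x y : V) :=
  [forall a : 'I_q.+1, forall b : 'I_q.+1, (b == a.+1 :> nat) ==> (x b == y a)].

Definition debruijn_adj (x y : V) := (x != y) && (shift x y || shift y x).

Lemma debruijn_sym : symmetric debruijn_adj.
Proof. by move=> x y; rewrite /debruijn_adj eq_sym orbC. Qed.

Lemma debruijn_irrefl : irreflexive debruijn_adj.
Proof. by move=> x; rewrite /debruijn_adj eqxx. Qed.

Definition debruijn : sgraph := SGraph debruijn_sym debruijn_irrefl.

(** An edge is determined by a word of length [q.+2]: the vertex [x] and the letter appended after
    dropping its first one. *)
Lemma card_edges_debruijn : #|edges debruijn| <= #|L| ^ q.+2.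
Proof.
pose next (x : V) c : V :=
  [ffun a : 'I_q.+1 => if insub a.+1 is Some b then x b else c].
have -> : #|L| ^ q.+2 = #|{: V * L}|.
  by rewrite card_prod card_ffun card_ord mulnC -expnS.
apply: leq_trans (leq_imset_card (fun p : V * L => [set p.1; next p.1 p.2]) _).
apply/subset_leq_card/subsetP => e.
rewrite inE => /existsP[x /existsP[y /andP[/andP[_ xy] /eqP->]]].
wlog {xy} xy : x y / shift x y.
  by case/orP: xy => [xy /(_ _ _ xy)//|yx /(_ _ _ yx)]; rewrite setUC.
apply/imsetP; exists (x, y ord_max) => //=; congr [set _; _].
apply/ffunP => a; rewrite ffunE; case: insubP => [b _ bE|].
  have /forallP/(_ b) := forallP xy a; rewrite bE eqxx /= => /eqP<-.
  by congr (x _).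
rewrite -leqNgt ltnS => aq; congr (y _); apply/val_inj => /=.
by apply/eqP; rewrite eqn_leq aq -ltnS ltn_ord.
Qed.

End DeBruijn.

Lemma subseq_map_nth (T : eqType) (x0 : T) (s : seq T) (ps : seq nat) :
  sorted ltn ps -> {in ps, forall p, p < size s} ->
  subseq [seq nth x0 s p | p <- ps] s.
Proof.
move=> ps_sorted ps_lt; have := map_nth_iota0 x0 (leqnn (size s)).
rewrite take_size => sE; rewrite -[X in subseq _ X]sE.
apply: map_subseq; have -> : ps = [seq p <- iota 0 (size s) | p \in ps].
  apply: (irr_sorted_eq ltn_trans ltnn) => //.
    by apply: sorted_filter (iota_ltn_sorted _ _); apply: ltn_trans.
  by move=> p; rewrite mem_filter mem_iota; case ps_p: (p \in ps); rewrite //= ps_lt.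
exact: filter_subseq.
Qed.

Lemma finite_pigeonhole (X Y : finType) (r : X -> Y -> bool) :
  0 < #|X| -> (forall x, exists y, r x y) ->
  exists y, #|X| <= #|Y| * #|[set x | r x y]|.
Proof.
move=> X_gt0 rP; have [x0 _] := card_gt0P X_gt0.
have Y_gt0 : 0 < #|Y| by apply/card_gt0P; have [y _] := rP x0; exists y.
apply/existsP; apply: contraT => /existsPn lt_r.
have le_X : #|X| <= \sum_y #|[set x | r x y]|.
  apply: leq_trans (leq_card_bigcup _ _); rewrite -cardsT.
  apply/subset_leq_card/subsetP => x _; have [y rxy] := rP x.
  by apply/bigcupP; exists y; rewrite ?inE.
have : #|Y| * #|X| <= \sum_(y : Y) #|X|.-1.
  apply: leq_trans (leq_mul (leqnn _) le_X) _; rewrite big_distrr leq_sum // => y _.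
  by have := lt_r y; rewrite -ltnNge -(prednK X_gt0) ltnS prednK.
by rewrite sum_nat_const leq_pmul2l // -(prednK X_gt0) ltnn.
Qed.

(** * Typed paths in the de Bruijn graph *)

Section Paths.
Variables (q R m : nat).
Local Notation W := {ffun 'I_q.+1 -> 'I_m}.
Local Notation V := (debruijn q ('I_R * 'I_m)%type).
Variable tau : nat -> 'I_R.

(** Block [i] consists of the types [tau] takes on the [q.+1] indices from [i * q.+1] on; this is
    the index for the [p]-th letter of a word of block [i] followed by one of block [j]. *)
Definition pos i j p := if p < q.+1 then i * q.+1 + p else j * q.+1 + (p - q.+1).

Definition letter i j (x y : W) p : 'I_R * 'I_m :=
  (tau (pos i j p), if p < q.+1 then x (inord p) else y (inord (p - q.+1))).

(* The [l]-th vertex of the path from the vertex [x] of type [i] to the vertex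
   [y] of type [j]: read [q.+1] consecutive letters of the word [x y]. *)
Definition window i j (x y : W) l : V := [ffun a : 'I_q.+1 => letter i j x y (l + a)].

Lemma pos_lt i j p p' : i < j -> p < p' -> pos i j p < pos i j p'.
Proof.
move=> ij pp'; have := leq_mul ij (leqnn q.+1); rewrite /pos mulSn.
by case: (ltnP p q.+1); case: (ltnP p' q.+1); lia.
Qed.

Lemma pos_bound t i j p : i < t -> j < t -> p < q.+1 + q.+1 -> pos i j p < t * q.+1.
Proof.
move=> it jt pq; have := leq_mul it (leqnn q.+1); have := leq_mul jt (leqnn q.+1).
by rewrite /pos !mulSn; case: (ltnP p q.+1); lia.
Qed.

(** Each end of a path depends on one word only, so paths at a common vertex of [H] do meet
    there. *)
Lemma window_start i j (x y : W) : window i j x y 0 = window i i x x 0.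
Proof. by apply/ffunP => a; rewrite !ffunE /letter /pos add0n ltn_ord. Qed.

Lemma window_end i j (x y : W) : window i j x y q.+1 = window j j y y 0.
Proof.
apply/ffunP => a; rewrite !ffunE /letter /pos add0n ltn_ord.
by rewrite ltnNge leq_addr /= addKn.
Qed.

Variable t : nat.
Hypothesis tau_inj : {in gtn (t * q.+1) &, injective tau}.

(** The types are distinct, so those in a window reveal its blocks and offset; its letters reveal a
    suffix of [x] and a prefix of [y]. *)
Lemma window_inj i j i' j' (x y x' y' : W) l l' :
  i < t -> j < t -> i' < t -> j' < t -> l < q.+1 -> l' < q.+1 ->
  window i j x y l = window i' j' x' y' l' ->
  [/\ i = i', l = l', 0 < l -> j = j',
    agree [set a : 'I_q.+1 | l <= a] x x' &
    agree (~: [set a : 'I_q.+1 | l <= a]) y y'].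
Proof.
move=> it jt i't j't lq l'q /ffunP winE.
have posE (a : 'I_q.+1) : pos i j (l + a) = pos i' j' (l' + a).
  have := winE a; rewrite !ffunE => -[/tau_inj posE _]; apply: posE;
  by rewrite unfold_in /= pos_bound //; have := ltn_ord a; lia.
have [ii' ll'] : i = i' /\ l = l'.
  (* The first letter has index [i * q.+1 + l] with [l < q.+1], so division recovers [i] and [l]. *)
  have := posE ord0; rewrite /pos !addn0 lq l'q => E.
  have := congr1 (divn^~ q.+1) E; have := congr1 (modn^~ q.+1) E.
  by rewrite /= !modnMDl !divnMDl // !modn_small // !divn_small // !addn0.
subst i' l'; split=> //.
- move=> l_gt0; have := posE ord_max; rewrite /pos /=.
  have -> : (l + q < q.+1) = false by lia.
  by move=> /addIn/eqP; rewrite eqn_pmul2r // => /eqP.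
- apply/forall_inP => a; rewrite inE => la; have aq := ltn_ord a.
  have lt_a : a - l < q.+1 by lia.
  have := winE (Ordinal lt_a); rewrite !ffunE /letter /= subnKC // aq => -[_].
  by rewrite inord_val => ->.
apply/forall_inP => a; rewrite !inE -ltnNge => al; have aq := ltn_ord a.
have lt_a : a + q.+1 - l < q.+1 by lia.
have := winE (Ordinal lt_a); rewrite !ffunE /letter /= subnKC; last by lia.
by rewrite ltnNge leq_addl /= addnK inord_val => -[_ ->].
Qed.

(** Consecutive windows differ because their first letters have different types. *)
Lemma window_adj i j (x y : W) l : i < j -> j < t -> l < q.+1 ->
  @adj V (window i j x y l) (window i j x y l.+1).
Proof.
move=> ij jt lq; have it := ltn_trans ij jt; apply/andP; split; last first.
  apply/orP; left; apply/forallP => a; apply/forallP => b; apply/implyP => /eqP ba.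
  by rewrite !ffunE ba addnS addSn.
apply/eqP => /ffunP/(_ ord0); rewrite !ffunE !addn0 => -[/tau_inj E _].
have := pos_lt ij (ltnSn l); rewrite E ?ltnn //.
  by rewrite unfold_in /= pos_bound //; lia.
by rewrite unfold_in /= pos_bound //; lia.
Qed.

Variables (r : nat) (col : {set V} -> 'I_r) (k : 'I_r).

Definition mono_path i j (x y : W) :=
  [forall l : 'I_q.+1, col [set window i j x y l; window i j x y l.+1] == k].

Definition mono_cliques (n : nat) : {set {ffun 'I_n -> W}} :=
  [set u : {ffun 'I_n -> W} | [forall i : 'I_n, forall j : 'I_n,
    (i < j) ==> mono_path i j (u i) (u j)]].

End Paths.

(* Sample one letter of each type: by Ramsey's theorem every sample contains a
   monochromatic set of [t * q.+1] types, and one such set and colour serve a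
   positive proportion of the samples. *)
Lemma dense_mono_cliques (q t r : nat) : exists R c, 0 < c /\
  forall m (col : {set debruijn q ('I_R * 'I_m)%type} -> 'I_r), 0 < m ->
  exists (tau : nat -> 'I_R) (k : 'I_r),
    {in gtn (t * q.+1) &, injective tau} /\
    #|{: {ffun 'I_q.+1 -> 'I_m}}| ^ t <= c * #|mono_cliques tau col k t|.
Proof.
(* An edge of a path reads [q.+2] consecutive letters, hence the uniformity [q.+2]. *)
have [R0 ramsey] := ramsey_subseq r q.+2 (t * q.+1).
(* The constant exceeds the number of pairs of a tuple of types and a colour; the successors provide
   [ord0] and positivity. *)
exists R0.+1, (R0.+1 ^ (t * q.+1) * r).+1; split=> // m col m_gt0.
pose T := (t * q.+1).-tuple 'I_R0.+1.
pose W : finType := {ffun 'I_q.+1 -> 'I_m}.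
pose tau (s : T) p := nth ord0 s p.
pose proj (s : T) (sg : {ffun 'I_R0.+1 -> 'I_m}) : {ffun 'I_t -> W} :=
  [ffun i : 'I_t => [ffun a : 'I_q.+1 => sg (tau s (i * q.+1 + a))]].
pose good sg (sk : T * 'I_r) :=
  uniq sk.1 && (proj sk.1 sg \in mono_cliques (tau sk.1) col sk.2 t).
have good_ex sg : exists sk, good sg sk.
  pose word x l := [ffun a : 'I_q.+1 =>
    (nth ord0 x (l + a), sg (nth ord0 x (l + a)))] : debruijn q ('I_R0.+1 * 'I_m)%type.
  have [|k [s [sub_s sz_s sP]]] := ramsey _
    (fun x => col [set word x 0; word x 1]) (enum 'I_R0.+1).
    by rewrite size_enum_ord.
  have s_size : size s == t * q.+1 by apply/eqP.
  exists (Tuple s_size, k); rewrite /good (subseq_uniq sub_s (enum_uniq _)) /=.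
  rewrite inE; apply/forallP => i; apply/forallP => j; apply/implyP => ij.
  apply/forallP => l; apply/eqP.
  pose ps := [seq pos q i j p | p <- iota l q.+2].
  have ps_lt : {in ps, forall p, p < size s}.
    move=> _ /mapP[p + ->]; rewrite mem_iota sz_s => /andP[_ pl].
    by apply: pos_bound; rewrite ?ltn_ord //; have := ltn_ord l; lia.
  rewrite -(sP [seq nth ord0 s p | p <- ps]); first last.
  - by rewrite !size_map size_iota.
  - apply: subseq_map_nth ps_lt; apply: (homo_sorted _ _ (iota_ltn_sorted _ _)).
    by move=> p p' pp'; apply: pos_lt.
  have word_window e : e <= 1 ->
      word [seq nth ord0 s p | p <- ps] e = window (tau (Tuple s_size)) i j
        (proj (Tuple s_size) sg i) (proj (Tuple s_size) sg j) (l + e).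
    move=> e1; apply/ffunP => a; rewrite !ffunE /letter.
    have ea : e + a < q.+2 by have := ltn_ord a; lia.
    rewrite (nth_map 0) ?size_map ?size_iota // (nth_map 0) ?size_iota // nth_iota //.
    rewrite addnA /tau /= /pos; congr (_, _).
    have lq := ltn_ord l; have aq := ltn_ord a.
    by case: ltnP => lea; rewrite !ffunE /tau /= inordK //; lia.
  by rewrite !word_window // addn0 addn1.
have [|[s k] le_good] := finite_pigeonhole _ good_ex.
  by rewrite card_ffun !card_ord expn_gt0 m_gt0.
have s_uniq : uniq s.
  apply: contraLR le_good => /negPf nus; rewrite -ltnNge.
  rewrite (_ : [set x | _] = set0) ?cards0 ?muln0.
    by rewrite card_ffun !card_ord expn_gt0 m_gt0.
  by apply/setP => sg; rewrite !inE /good /= nus.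
exists (tau s), k; split.
  move=> p p'; rewrite !unfold_in /= => pT p'T /eqP.
  by rewrite /tau nth_uniq ?size_tuple // => /eqP.
set K := mono_cliques _ _ _ _.
pose C := {x : 'I_R0.+1 | x \notin s}.
pose rest sg : {ffun C -> 'I_m} := [ffun x => sg (val x)].
(* A sample is determined by its letters on the types in [s], which form a clique, and on the
   remaining types. *)
have le_K : #|[set sg | good sg (s, k)]| <= #|K| * m ^ #|{: C}|.
  have -> : #|K| * m ^ #|{: C}| = #|setX K [set: {ffun C -> 'I_m}]|.
    by rewrite cardsX cardsT card_ffun card_ord.
  rewrite -(@card_in_imset _ _ (fun sg => (proj s sg, rest sg))).
    apply/subset_leq_card/subsetP => _ /imsetP[sg + ->].
    by rewrite !inE /good /= andbT => /andP[_]; rewrite inE.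
  move=> sg sg' _ _ [/ffunP proj_eq /ffunP rest_eq]; apply/ffunP => x.
  have [xs|xs] := boolP (x \in s); last first.
    by have := rest_eq (Sub x xs); rewrite !ffunE.
  have := xs; rewrite -index_mem size_tuple => lt_x.
  have lt_i : index x s %/ q.+1 < t by rewrite ltn_divLR.
  have lt_a : index x s %% q.+1 < q.+1 by rewrite ltn_mod.
  have /ffunP/(_ (Ordinal lt_a)) := proj_eq (Ordinal lt_i).
  by rewrite !ffunE /= /tau -divn_eq nth_index.
have card_C : t * q.+1 + #|{: C}| = R0.+1.
  rewrite card_sig; have := cardC (mem s).
  by rewrite (card_uniqP s_uniq) size_tuple card_ord.
have mR : m ^ R0.+1 = m ^ (t * q.+1) * m ^ #|{: C}| by rewrite -expnD card_C.
move: le_good; rewrite card_prod card_tuple !card_ffun !card_ord mR.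
move=> /leq_trans/(_ (leq_mul (leqnn _) le_K)).
rewrite mulnA leq_pmul2r ?expn_gt0 ?m_gt0 // mulnC expnM => /leq_trans; apply.
by rewrite leq_mul2r leqnSn orbT.
Qed.

(** * Embedding the subdivision along the paths *)

Section SubdivisionEmbedding.
Variables (q R m t r : nat) (H : sgraph) (f : H -> 'I_t).
Local Notation W := {ffun 'I_q.+1 -> 'I_m}.
Local Notation V := (debruijn q ('I_R * 'I_m)%type).
Variables (tau : nat -> 'I_R) (col : {set V} -> 'I_r) (k : 'I_r) (phi : H -> W).
Hypothesis tau_inj : {in gtn (t * q.+1) &, injective tau}.
Hypothesis f_adj : forall x y, adj x y -> f x != f y.
Hypothesis f_dist2 : forall z x y, adj z x -> adj z y -> f x = f y -> x = y.
Hypothesis phi_mono : forall x y, adj x y -> f x < f y ->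
  mono_path tau col k (f x) (f y) (phi x) (phi y).
Hypothesis phi_inj : forall x y, f x = f y -> phi x = phi y -> x = y.
Hypothesis phi_disjoint : forall (x y x' y' : H) (P : {set 'I_q.+1}),
  adj x y -> adj x' y' -> f x = f x' -> f y = f y' -> P != set0 -> P != setT ->
  agree P (phi x) (phi x') -> agree (~: P) (phi y) (phi y') -> x = x'.

(** Arcs follow the enumeration order of [H], host paths the order of the colours; [level] reverses
    the numbering where these disagree. *)
Definition forward (a : Defs.arc H) := f (val a).1 < f (val a).2.
Definition low (a : Defs.arc H) := if forward a then (val a).1 else (val a).2.
Definition high (a : Defs.arc H) := if forward a then (val a).2 else (val a).1.
Definition level (a : Defs.arc H) i := if forward a then i else q.+1 - i.

Definition place (x y : H) l : V := window tau (f x) (f y) (phi x) (phi y) l.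

Definition subdiv_map (v : subdiv q.+1 H) : V :=
  match v with
  | inl x => place x x 0
  | inr (a, o) => place (low a) (high a) (level a o.+1)
  end.

Lemma arc_adj a : adj (low a) (high a).
Proof.
by rewrite /low /high; case: (forward a); case: a => -[x y] /= /andP[xy _];
  rewrite // adj_sym.
Qed.

Lemma arc_lt a : f (low a) < f (high a).
Proof.
rewrite /low /high; case aE: (forward a); first exact: aE.
rewrite ltn_neqAle leqNgt -/(forward a) aE andbT eq_sym.
by case: a {aE} => -[x y] /= /andP[xy _]; apply: (f_adj xy).
Qed.

Lemma arc_inj a a' : low a = low a' -> high a = high a' -> a = a'.
Proof.
move=> lowE highE; apply/val_inj; move: lowE highE.
have /andP[_] := valP a; have /andP[_] := valP a'; rewrite /low /high /forward.
case: (val a) => x y; case: (val a') => x' y' /= lt' lt.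
by case: ifP => _; case: ifP => _ xE yE; subst => //;
  have := ltn_trans lt lt'; rewrite ltnn.
Qed.

Lemma subdiv_map_path a i : i <= q.+1 ->
  subdiv_map (path_vertex q.+1 a i) = place (low a) (high a) (level a i).
Proof.
rewrite /low /high /level; case: i => [|i] iq /=.
  case: (forward a); first by rewrite /place [RHS]window_start.
  by rewrite subn0 /place window_end.
case: insubP => [o _ oE|] /=; first by rewrite /low /high /level oE.
rewrite -leqNgt => qi; have -> : i = q by apply/eqP; rewrite eqn_leq -ltnS iq qi.
by case: (forward a); rewrite ?subnn /place ?window_end // [RHS]window_start.
Qed.

Lemma level_bounds a (o : 'I_q.+1.-1) : 0 < level a o.+1 < q.+1.
Proof. by have := ltn_ord o; rewrite /level /=; case: (forward a); lia. Qed.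

Lemma subdiv_map_inj : injective subdiv_map.
Proof.
have inj0 x (a : Defs.arc H) (o : 'I_q.+1.-1) :
    place x x 0 <> place (low a) (high a) (level a o.+1).
  have /andP[l0 lq] := level_bounds a o.
  by case/(window_inj tau_inj) => // _ E; rewrite -E in l0.
move=> [x|[a o]] [x'|[a' o']] /=.
- case/(window_inj tau_inj) => // /val_inj fE _ _ /forall_inP aP _.
  congr inl; apply: phi_inj fE _; apply/ffunP => b.
  by apply/eqP/aP; rewrite inE.
- by move/inj0.
- by move/esym/inj0.
have /andP[l0 lq] := level_bounds a o; have /andP[l0' lq'] := level_bounds a' o'.
case/(window_inj tau_inj) => // /val_inj fE lE /(_ l0)/val_inj fE' aP aP'.
(* As [0 < level < q.+1], the set of shared suffix positions is neither empty nor full, so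
   [phi_disjoint] applies. *)
have lowE : low a = low a'.
  apply: phi_disjoint (arc_adj a) (arc_adj a') fE fE' _ _ aP aP'.
    by apply/set0Pn; exists ord_max; rewrite inE.
  by apply/eqP => /setP/(_ ord0); rewrite !inE leqn0 => /eqP E; rewrite E in l0.
have highE : high a = high a'.
  by apply: f_dist2 (arc_adj a) _ fE'; rewrite lowE arc_adj.
have aE := arc_inj lowE highE; subst a'; congr (inr (_, _)); apply/val_inj => /=.
have := ltn_ord o; have := ltn_ord o'; move: lE; rewrite /level /=.
by case: (forward a); lia.
Qed.

Lemma subdiv_map_adj (u v : subdiv q.+1 H) : adj u v ->
  adj (subdiv_map u) (subdiv_map v) /\ col [set subdiv_map u; subdiv_map v] = k.
Proof.
move=> /existsP[a /existsP[i]].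
wlog uv : u v / (u == path_vertex q.+1 a i) && (v == path_vertex q.+1 a i.+1).
  move=> wl /orP[uv|vu]; first by apply: wl; rewrite uv.
  by rewrite adj_sym setUC; apply: wl; rewrite vu.
move=> _; case/andP: uv => /eqP-> /eqP->.
have iq := ltn_ord i; rewrite !subdiv_map_path //; last exact: ltnW.
have low_high l : l < q.+1 ->
    adj (place (low a) (high a) l) (place (low a) (high a) l.+1) /\
    col [set place (low a) (high a) l; place (low a) (high a) l.+1] = k.
  move=> lq; split; first exact: (window_adj tau_inj _ _ (arc_lt a)).
  have /forallP/(_ (Ordinal lq))/eqP := phi_mono (arc_adj a) (arc_lt a).
  exact.
rewrite /level; case: (forward a); first exact: low_high.
have -> : q.+1 - i = (q.+1 - i.+1).+1 by lia.
by rewrite adj_sym setUC; apply: low_high; lia.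
Qed.

End SubdivisionEmbedding.

(** * Choice of constants and the final bound *)

Lemma universal_graph (D q r : nat) : 0 < D ->
  exists C, forall n k, 0 < n -> n <= k ^ q.+1 -> exists G : sgraph,
    #|edges G| <= (C * k) ^ q.+2 /\
    forall H : sgraph, #|H| = n -> max_degree H <= D -> arrows r G (subdiv q.+1 H).
Proof.
move=> D_gt0; pose t := (D + D * D).+1.
have [R [c0 [c0_gt0 dense]]] := dense_mono_cliques q t r.
pose A := 2 * c0; pose E := D * (4 * A ^ D); pose c := c0 ^ (4 * E ^ 2).
pose b := D * 2 ^ q.+1 * (4 * A ^ D * c).
(* With [m = M * k], the first summand gives [m_large] and the second, with [n <= k ^ q.+1], gives
   [mq_large]. *)
pose M := 2 * b + (1 + 2 ^ q.+1 * (2 * b)) * (4 * A ^ D * c).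
have A_gt0 : 0 < A by rewrite muln_gt0.
have E_gt0 : 0 < E by rewrite !muln_gt0 D_gt0 expn_gt0 A_gt0.
have c_gt0 : 0 < c by rewrite expn_gt0 c0_gt0.
have b_gt0 : 0 < b by rewrite !muln_gt0 D_gt0 c_gt0 !expn_gt0 A_gt0.
have M_b : 2 * b <= M by apply: leq_addr.
have M_gt0 : 0 < M by apply: leq_trans M_b; rewrite muln_gt0.
exists (R * M) => n k n_gt0 le_n.
have k_gt0 : 0 < k.
  by rewrite lt0n; apply: contraTneq le_n => ->; rewrite exp0n // -ltnNge.
exists (debruijn q ('I_R * 'I_(M * k))%type); split.
  by apply: leq_trans (card_edges_debruijn _ _) _; rewrite card_prod !card_ord mulnA.
move=> H cardH degH col; set m := M * k in col *.
have m_gt0 : 0 < m by rewrite muln_gt0 M_gt0.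
have [tau [a [tau_inj le_K]]] := dense m col m_gt0.
pose W : finType := {ffun 'I_q.+1 -> 'I_m}.
(* Paths run from the smaller index to the larger, which makes [G] symmetric. *)
pose G (i j : 'I_t) (x y : W) := if i < j then mono_path tau col a i j x y
  else (j < i) ==> mono_path tau col a j i y x.
have cardW : #|W| = m ^ q.+1 by rewrite card_ffun !card_ord.
have W_gt0 : 0 < #|W| by rewrite cardW expn_gt0 m_gt0.
have KG u i j : u \in mono_cliques tau col a t -> i != j -> G i j (u i) (u j).
  rewrite inE => /forallP uK nij; rewrite /G.
  case: ltnP => [ij|_]; first by have /forallP/(_ j)/implyP -> := uK i.
  by have /forallP/(_ i) := uK j.
have [X [X_large X_reg]] := regular_boxes W_gt0 E_gt0 le_K KG.
have [f [f_adj f_dist2]] := distance2_colouring degH.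
have [||||phi pe] := @full_embedding q.+1 m t G X H f A E b c D _ _ X_reg f_adj
  f_dist2 degH A_gt0 D_gt0 c_gt0 (leqnn _) (leqnn _).
- by move=> i j x y; rewrite /G; case: (ltngtP i j).
- by move=> i; rewrite -cardW; apply: X_large.
- by apply: leq_trans M_b _; rewrite leq_pmulr.
- rewrite /m expnMn cardH.
  have -> : (n + 2 ^ q.+1 * (2 * b * n)) * (4 * A ^ D * c) =
      (1 + 2 ^ q.+1 * (2 * b)) * (4 * A ^ D * c) * n by lia.
  apply: leq_mul le_n; apply: leq_trans (leq_addl (2 * b) _) _.
  by rewrite -/M expnS leq_pmulr // expn_gt0 M_gt0.
have inT (x : H) : x \in [set: H] by rewrite inE.
exists (subdiv_map f tau phi), a; split.
  apply: subdiv_map_inj => //.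
  - by move=> x y; apply: (pe_inj pe).
  - by move=> x y x' y' P; apply: (pe_disjoint pe).
apply: subdiv_map_adj => // x y xy lt_xy.
by have := pe_adj pe (inT x) (inT y) xy; rewrite /G lt_xy.
Qed.

Lemma min_edges_le (P : sgraph -> Prop) (exP : exists G, P G) (G : sgraph) :
  P G -> min_edges exP <= #|edges G|.
Proof.
move=> PG; rewrite /min_edges; case: ex_minnP => m _; apply.
by apply/boolp.asboolP; exists G.
Qed.

Lemma min_edges_witness (P : sgraph -> Prop) (exP : exists G, P G) :
  exists2 G, P G & #|edges G| = min_edges exP.
Proof.
rewrite /min_edges; case: ex_minnP => m /boolp.asboolP[G [<- PG]] _.
by exists G.
Qed.

Lemma USR_bound (D q r : nat) : 0 < D -> exists C, forall n k,
  0 < n -> n <= k ^ q.+1 -> USR D q.+1 r n <= (C * k) ^ q.+2.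
Proof.
move=> D_gt0; have [C CP] := universal_graph q r D_gt0; exists C => n k n_gt0 nk.
by have [G [le_G GP]] := CP n k n_gt0 nk; apply: leq_trans le_G; apply: min_edges_le.
Qed.

Unset Implicit Arguments.
Set Strict Implicit.
Local Open Scope ring_scope.

Theorem corollary1p2 (R : realType) (D q r : nat)
    (hD : (2 <= D)%N) (hq : (2 <= q)%N) (hr : (2 <= r)%N) :
  exists c : R, forall n : nat, (0 < n)%N ->
    forall H : sgraph, #|H| = n -> (max_degree H < D)%N ->
      (size_ramsey r (subdiv q H))%:R <= (USR D q r n)%:R :> R /\
      (USR D q r n)%:R <= c * powR n%:R (1 + q%:R^-1).
Proof.
case: q hq => // q _; have [C CP] := USR_bound q r (ltnW hD).
exists ((C * 2)%:R ^+ q.+2) => n n_gt0 H cardH degH; split.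
  rewrite ler_nat /USR.
  (* An optimal universal graph is in particular Ramsey for this subdivision. *)
  have [G GP <-] := min_edges_witness (universal_ramsey_exists D q.+1 r n).
  by apply: min_edges_le; apply: GP cardH (ltnW degH).
have ex_k : exists k, (n <= k ^ q.+1)%N.
  by exists n; rewrite expnS leq_pmulr // expn_gt0 n_gt0.
case: (ex_minnP ex_k) => k nk k_min.
pose x : R := powR n%:R q.+1%:R^-1.
have xE : x ^+ q.+1 = n%:R.
  by rewrite -powR_mulrn ?powR_ge0 // -powRrM mulVf ?pnatr_eq0 // powRr1.
have x0 : 0 <= x by apply: powR_ge0.
have x1 : 1 <= x.
  by rewrite -(@ler_pXn2r _ q.+1) ?nnegrE ?ler01 // xE expr1n ler1n.
(* By minimality [k - 1 < x], and [1 <= x]; this is the factor 2 in the constant. *)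
have kx : k%:R <= 2 * x.
  case: k k_min {nk} => [|k] k_min; first by rewrite mulr_ge0.
  have /ltW : (k%:R : R) < x.
    rewrite -(@ltr_pXn2r _ q.+1) ?nnegrE // xE -natrX ltr_nat ltnNge.
    by apply/negP => /k_min; rewrite ltnn.
  by rewrite mulr_natl mulr2n -(natr1 k) => k_le; apply: lerD.
have -> : powR n%:R (1 + q.+1%:R^-1) = x ^+ q.+2 :> R.
  rewrite powRD ?powRr1 // ?pnatr_eq0 -?lt0n ?n_gt0 ?implybT // -/x.
  by rewrite [RHS]exprSr xE.
apply: le_trans (_ : ((C * k) ^ q.+2)%:R <= _); first by rewrite ler_nat CP.
rewrite natrX -exprMn lerXn2r ?nnegrE // ?mulr_ge0 //.
by rewrite !natrM -mulrA ler_wpM2l.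
Qed.
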